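(* Let $(\lambda_k)_{k\ge 1}$ be a nondecreasing sequence of positive real numbers tending to infinity with $\lambda_1=1$ and $\lambda_{k+1}\le\lambda_k+1$ for all $k$, and let $p=(p_k)_{k\ge1}$ be a bounded sequence of real numbers with $p_k>1$ for all $k$. Then the space $V_\rho(\lambda;p)$, equipped with the Luxemburg norm $\|\cdot\|_L$, has the Kadec-Klee property.
   Context: $\ell^0$ denotes the space of all real sequences $x=(x(j))_{j\ge1}$, with coordinatewise operations. For each $k\ge1$, $I_k=[k-\lambda_k+1,k]$, and $j\in I_k$ means that $j$ is a positive integer with $k-\lambda_k+1\le j\le k$. Define $\rho:\ell^0\to[0,\infty]$ by $$\rho(x)=\sum_{k=1}^{\infty}\left(\frac{1}{\lambda_k}\sum_{j\in I_k}|x(j)|\right)^{p_k},$$ $$V_\rho(\lambda;p)=\{x\in\ell^0:\ \rho(\sigma x)<\infty\text{ for some }\sigma>0\},$$ and the Luxemburg norm on $V_\rho(\lambda;p)$ by $$\|x\|_L=\inf\left\{\sigma>0:\ \rho\left(\frac{x}{\sigma}\right)\le1\right\};$$ with this norm $V_\rho(\lambda;p)$ is a Banach space. A Banach space $X$ has the Kadec-Klee property (property (H)) if every weakly convergent sequence on the unit sphere of $X$ whose weak limit lies in the unit sphere is convergent in norm. *)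

(* Defs.v *)
From HB Require Import structures.
From mathcomp Require Import all_boot all_order all_algebra.
From mathcomp Require Import ring lra.
From mathcomp Require Import all_classical all_reals all_analysis.
Set Implicit Arguments.
Unset Strict Implicit.
Unset Printing Implicit Defensive.
Import Order.TTheory GRing.Theory Num.Theory.
Import numFieldNormedType.Exports.
Local Open Scope classical_set_scope.
Local Open Scope ring_scope.

(* Sequences indexed by k = 1, 2, ... are functions on nat, the index n       *)
(* standing for k = n + 1. The condition k - lam_k + 1 <= j <= k defining the *)
(* window I_k is invariant under shifting j and k together, and the positive  *)
(* integers j become the natural numbers.                                     *)
Definition window_mean {R : realType} (lam x : nat -> R) (k : nat) : R :=
  (lam k)^-1 * \sum_(j < k.+1 | k%:R - lam k + 1 <= j%:R) `|x j|.

(* Locked: unifying two instances of the series by unfolding is very slow. *)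
HB.lock Definition rho {R : realType} (lam p x : nat -> R) : \bar R :=
  (\sum_(0 <= k <oo) (window_mean lam x k `^ p k)%:E)%E.
Canonical rho_unlockable := Unlockable rho.unlock.
Arguments rho {R} lam p x.

Lemma rhoE {R : realType} (lam p x : nat -> R) :
  rho lam p x = (\sum_(0 <= k <oo) (window_mean lam x k `^ p k)%:E)%E.
Proof. by rewrite unlock. Qed.

Definition Vrho_pred {R : realType} (lam p : nat -> R) : {pred nat -> R} :=
  mem [set x | exists2 sigma : R, 0 < sigma & (rho lam p (sigma *: x)%R < +oo)%E].

Definition luxemburg {R : realType} (lam p x : nat -> R) : R :=
  inf [set sigma : R | 0 < sigma /\ (rho lam p (sigma^-1 *: x)%R <= 1)%E].

Lemma Vrho_predP {R : realType} (lam p x : nat -> R) :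
  x \in Vrho_pred lam p <->
  exists2 sigma : R, 0 < sigma & (rho lam p (sigma *: x)%R < +oo)%E.
Proof. by split=> [/set_mem|/mem_set]. Qed.

(* The proof arguments do not affect the carrier; the norm axioms need them.  *)
Record Vrho (R : realType) (lam p : nat -> R)
    (lam_nd : nondecreasing_seq lam) (lam0 : lam 0%N = 1)
    (p_gt1 : forall k, 1 < p k) :=
  MkVrho { Vrho_seq :> nat -> R; _ : Vrho_seq \in Vrho_pred lam p }.

Section modular_theory.
Context {R : realType} (lam p : nat -> R).
Context (lam_nd : nondecreasing_seq lam) (lam0 : lam 0%N = 1)
  (p_gt1 : forall k, 1 < p k).
Implicit Types (x y : nat -> R) (a b s t : R).

Let lam_ge1 k : 1 <= lam k.
Proof. by rewrite -lam0; exact: lam_nd. Qed.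

Let lam_gt0 k : 0 < lam k.
Proof. exact: lt_le_trans (lam_ge1 k). Qed.

Let p_gt0 k : 0 < p k.
Proof. exact: lt_trans (p_gt1 k). Qed.

Lemma window_mean_ge0 x k : 0 <= window_mean lam x k.
Proof. by apply: mulr_ge0; [rewrite invr_ge0 ltW | exact: sumr_ge0]. Qed.

Lemma window_meanZ a x k :
  window_mean lam (a *: x) k = `|a| * window_mean lam x k.
Proof.
rewrite /window_mean mulrCA; congr (_ * _); rewrite mulr_sumr.
by apply: eq_bigr => j _; rewrite -normrM.
Qed.

Lemma window_meanD x y k :
  window_mean lam (x + y) k <= window_mean lam x k + window_mean lam y k.
Proof.
rewrite /window_mean -mulrDr ler_wpM2l ?invr_ge0 ?(ltW (lam_gt0 k))//.
by rewrite -big_split/=; apply: ler_sum => j _; exact: ler_normD.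
Qed.

Lemma rho_ge0 x : (0 <= rho lam p x)%E.
Proof. by rewrite rhoE; apply: nneseries_ge0 => k _ _; rewrite lee_fin powR_ge0. Qed.

Lemma rho0 : rho lam p 0 = 0%E.
Proof.
rewrite rhoE; apply: eseries0 => k _ _.
have -> : (0 : nat -> R) = 0 *: 0 by rewrite scale0r.
by rewrite window_meanZ normr0 mul0r powR0// gt_eqF.
Qed.

Lemma rho_abs a x : rho lam p (`|a| *: x) = rho lam p (a *: x).
Proof. by rewrite !rhoE; apply: eq_eseriesr => k _; rewrite !window_meanZ normr_id. Qed.

Lemma rho_convex a b x y : 0 <= a -> 0 <= b -> a + b = 1 ->
  (rho lam p (a *: x + b *: y)%R <= a%:E * rho lam p x + b%:E * rho lam p y)%E.
Proof.
move=> a0 b0 ab1.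
rewrite !rhoE -!nneseriesZl; try by move=> k _; rewrite lee_fin powR_ge0.
rewrite -nneseriesD; try by move=> k _ _; rewrite mule_ge0 ?lee_fin ?powR_ge0.
apply: lee_nneseries => [k _ _|k _]; first by rewrite lee_fin powR_ge0.
rewrite -!EFinM -EFinD lee_fin.
have b1 : b <= 1 by rewrite -ab1 lerDr.
set u := window_mean lam x k; set v := window_mean lam y k.
have uv0 : 0 <= a * u + b * v.
  by rewrite addr_ge0// mulr_ge0// window_mean_ge0.
apply: (@le_trans _ _ ((a * u + b * v) `^ p k)).
  rewrite ge0_ler_powR ?nnegrE ?window_mean_ge0 ?(ltW (p_gt0 k))//.
  rewrite (le_trans (window_meanD _ _ _))// !window_meanZ.
  by rewrite (ger0_norm a0) (ger0_norm b0).
have a1 : a <= 1 by rewrite -ab1 lerDl.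
have ba : b = 1 - a by rewrite -ab1 addrAC subrr add0r.
have := @convex_powR R (p k) (ltW (p_gt1 k)) (Itv01 a0 a1) u v.
rewrite !inE/= !in_itv/= !window_mean_ge0 => /(_ isT isT).
by rewrite ba !convRE/=.
Qed.

Lemma rhoZ_le a x : 0 <= a <= 1 ->
  (rho lam p (a *: x)%R <= a%:E * rho lam p x)%E.
Proof.
move=> /andP[a0 a1].
have := @rho_convex a (1 - a) x 0 a0; rewrite subr_ge0 => /(_ a1).
by rewrite scaler0 addr0 rho0 mule0 adde0; apply; lra.
Qed.

Lemma Vrho_submod_closed : submod_closed (Vrho_pred lam p).
Proof.
split.
  by apply/Vrho_predP; exists 1 => //; rewrite scaler0 rho0 ltry.
move=> a x y /Vrho_predP[s s0 xs] /Vrho_predP[t t0 yt].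
apply/Vrho_predP.
have a1 : 0 < `|a| + 1 by rewrite ltr_wpDl.
have d0 : 0 < t * (`|a| + 1) + s by rewrite addr_gt0// mulr_gt0.
pose r := s * t / (t * (`|a| + 1) + s).
have r0 : 0 < r by rewrite divr_gt0// mulr_gt0.
exists r => //.
pose c := r * (`|a| + 1) / s; pose d := r / t.
have c0 : 0 <= c by rewrite ltW// /c !divr_gt0// mulr_gt0.
have d'0 : 0 <= d by rewrite ltW// divr_gt0.
have cd1 : c + d = 1.
  by rewrite /c /d /r; field; rewrite !gt_eqF.
pose e := a / (`|a| + 1).
have e1 : 0 <= `|e| <= 1.
  rewrite normr_ge0/= normrM normfV (ger0_norm (ltW a1)).
  by rewrite ler_pdivrMr// mul1r lerDl.
have -> : r *: (a *: x + y) = c *: (e *: (s *: x)) + d *: (t *: y).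
  rewrite scalerDr !scalerA /c /d /e; congr (_ *: _ + _ *: _).
    by field; rewrite !gt_eqF.
  by rewrite divfK// gt_eqF.
apply: le_lt_trans (rho_convex _ _ c0 d'0 cd1) _.
apply: lte_add_pinfty; apply: lte_mul_pinfty; rewrite ?lee_fin//.
rewrite -rho_abs; apply: le_lt_trans (rhoZ_le _ e1) _.
by apply: lte_mul_pinfty => //; rewrite lee_fin; case/andP: e1.
Qed.

Let adm x : set R :=
  [set s | 0 < s /\ (rho lam p (s^-1 *: x)%R <= 1)%E].

Let adm_lb x : lbound (adm x) 0.
Proof. by move=> s [/ltW]. Qed.

Let adm_has_lb x : has_lbound (adm x).
Proof. by exists 0; exact: adm_lb. Qed.

Let adm_nonempty x : x \in Vrho_pred lam p -> adm x !=set0.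
Proof.
move=> /Vrho_predP[s s0 xs].
have xfin : rho lam p (s *: x) \is a fin_num by rewrite ge0_fin_numE// rho_ge0.
have m0 : 0 <= fine (rho lam p (s *: x)) by rewrite fine_ge0// rho_ge0.
set m := fine (rho lam p (s *: x)) in m0.
have m1 : 0 < 1 + m by rewrite ltr_wpDr.
exists (s^-1 * (1 + m)); split; first by rewrite mulr_gt0// invr_gt0.
rewrite invfM invrK mulrC -scalerA.
apply: (le_trans (rhoZ_le _ _)).
  by rewrite invr_ge0 ltW//= invf_le1// lerDl.
by rewrite -(fineK xfin) -EFinM lee_fin -/m mulrC ler_pdivrMr// mul1r lerDr.
Qed.

Lemma luxemburg0 : luxemburg lam p 0 = 0.
Proof.
apply/eqP; rewrite eq_le; apply/andP; split; last first.
  apply: lb_le_inf; last exact: (adm_lb (x := 0)).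
  by exists 1; split => //; rewrite scaler0 rho0.
apply/ler_addgt0Pr => e e0; rewrite add0r; apply: ge_inf.
  exact: (adm_has_lb 0).
by split => //; rewrite scaler0 rho0.
Qed.

Lemma luxemburgD x y : x \in Vrho_pred lam p -> y \in Vrho_pred lam p ->
  luxemburg lam p (x + y) <= luxemburg lam p x + luxemburg lam p y.
Proof.
move=> Vx Vy.
have key s t : adm x s -> adm y t -> luxemburg lam p (x + y) <= s + t.
  move=> [s0 xs] [t0 yt]; apply: ge_inf; first exact: (adm_has_lb (x + y)).
  have st0 : 0 < s + t by exact: addr_gt0.
  split => //.
  have -> : (s + t)^-1 *: (x + y) =
      (s / (s + t)) *: (s^-1 *: x) + (t / (s + t)) *: (t^-1 *: y).
    rewrite scalerDr !scalerA; congr (_ *: _ + _ *: _).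
      by field; rewrite !gt_eqF.
    by field; rewrite !gt_eqF.
  have a0 : 0 <= s / (s + t) by rewrite divr_ge0 ?ltW.
  have b0 : 0 <= t / (s + t) by rewrite divr_ge0 ?ltW.
  have ab1 : s / (s + t) + t / (s + t) = 1 by rewrite -mulrDl divff// gt_eqF.
  apply: (le_trans (rho_convex _ _ a0 b0 ab1)).
  rewrite -[leRHS]/(1%:E) -ab1 EFinD; apply: leeD.
    by rewrite -[leRHS]mule1; apply: lee_wpmul2l.
  by rewrite -[leRHS]mule1; apply: lee_wpmul2l.
rewrite -lerBlDr; apply: lb_le_inf; first exact: adm_nonempty.
move=> s xs; rewrite lerBlDr -lerBlDl.
apply: lb_le_inf; first exact: adm_nonempty.
by move=> t yt; rewrite lerBlDl; exact: key.
Qed.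

Let luxemburgZ_le a x : a != 0 -> x \in Vrho_pred lam p ->
  luxemburg lam p (a *: x) <= `|a| * luxemburg lam p x.
Proof.
move=> a0 Vx; have na0 : 0 < `|a| by rewrite normr_gt0.
rewrite mulrC -ler_pdivrMr//; apply: lb_le_inf; first exact: adm_nonempty.
move=> s [s0 xs]; rewrite ler_pdivrMr//; apply: ge_inf.
  exact: (adm_has_lb (a *: x)).
split; first exact: mulr_gt0.
rewrite scalerA -rho_abs.
by rewrite normrM normfV normrM normr_id gtr0_norm// invfM divfK// gt_eqF.
Qed.

Lemma luxemburgZ a x : x \in Vrho_pred lam p ->
  luxemburg lam p (a *: x) = `|a| * luxemburg lam p x.
Proof.
move=> Vx; have [->|a0] := eqVneq a 0.
  by rewrite scale0r normr0 mul0r luxemburg0.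
apply/eqP; rewrite eq_le luxemburgZ_le//=.
have Vax : a *: x \in Vrho_pred lam p.
  have [V0 Vlin] := Vrho_submod_closed.
  by rewrite -[a *: x]addr0 Vlin.
have a'0 : a^-1 != 0 by rewrite invr_eq0.
have := luxemburgZ_le a'0 Vax.
rewrite scalerA mulVf// scale1r normfV => xax.
by rewrite mulrC -ler_pdivlMr ?normr_gt0// mulrC.
Qed.

Let coord_le x s k : 0 < s -> (rho lam p (s^-1 *: x)%R <= 1)%E ->
  `|x k| <= lam k * s.
Proof.
move=> s0 xs.
have : window_mean lam (s^-1 *: x) k `^ p k <= 1.
  rewrite -lee_fin; apply: le_trans xs.
  rewrite rhoE (@nneseriesD1 _ _ k)//; last first.
    by move=> i _; rewrite lee_fin powR_ge0.
  by rewrite leeDl//; apply: nneseries_ge0 => i _ _; rewrite lee_fin powR_ge0.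
rewrite leNgt => wk; have {wk} : window_mean lam (s^-1 *: x) k <= 1.
  rewrite leNgt; apply: contra wk => w1.
  have <- : 1 `^ p k = 1 :> R by rewrite powR1.
  by rewrite gt0_ltr_powR ?nnegrE ?window_mean_ge0.
rewrite window_meanZ gtr0_norm ?invr_gt0// mulrC ler_pdivrMr// mul1r.
rewrite /window_mean mulrC ler_pdivrMr// mulrC; apply: le_trans.
rewrite (bigD1 ord_max)/=; last by have := lam_ge1 k; lra.
by rewrite lerDl sumr_ge0.
Qed.

Lemma luxemburg_eq0 x : x \in Vrho_pred lam p -> luxemburg lam p x = 0 -> x = 0.
Proof.
move=> Vx x0; apply/funext => k; apply/eqP; rewrite -normr_le0.
apply/ler_addgt0Pr => e e0; rewrite add0r.
have hinf : has_inf (adm x) by split; [exact: adm_nonempty|exact: adm_has_lb].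
have [s [s0 xs]] := inf_adherent (divr_gt0 e0 (lam_gt0 k)) hinf.
rewrite -/(luxemburg lam p x) x0 add0r ltr_pdivlMr// => se.
by rewrite (le_trans (coord_le k s0 xs))// mulrC ltW.
Qed.

Local Notation V := (Vrho lam_nd lam0 p_gt1).

HB.instance Definition _ := [isSub for @Vrho_seq R lam p lam_nd lam0 p_gt1].
HB.instance Definition _ := [Choice of V by <:].
HB.instance Definition _ :=
  GRing.SubChoice_isSubLmodule.Build R _ _ V Vrho_submod_closed.

Let normV (x : V) : R := luxemburg lam p x.

Let normVD (x y : V) : normV (x + y) <= normV x + normV y.
Proof. by apply: luxemburgD; exact: valP. Qed.

Let normVZ a (x : V) : normV (a *: x) = `|a| * normV x.
Proof. by apply: luxemburgZ; exact: valP. Qed.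

Let normV_eq0 (x : V) : normV x = 0 -> x = 0.
Proof. by move=> /luxemburg_eq0 x0; apply: val_inj; rewrite /= x0//; exact: valP. Qed.

HB.instance Definition _ :=
  Lmodule_isNormed.Build R V normVD normVZ normV_eq0.

Lemma Vrho_normE (x : V) : `|x| = luxemburg lam p x.
Proof. by []. Qed.

End modular_theory.

(* A sequence converges weakly when every element of the topological dual     *)
(* converges along it.                                                        *)
Definition weakly_cvg (R : realType) (X : normedModType R)
    (u : nat -> X) (l : X) : Prop :=
  forall f : {linear X -> R^o}, continuous f -> f (u n) @[n --> \oo] --> f l.

Definition kadec_klee (R : realType) (X : normedModType R) : Prop :=
  forall (u : nat -> X) (l : X), (forall n, `|u n| = 1) -> `|l| = 1 ->
    weakly_cvg u l -> u @ \oo --> l.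

(* Main.v *)
Require Import Defs.
From HB Require Import structures.
From mathcomp Require Import all_boot all_order all_algebra.
From mathcomp Require Import ring lra.
From mathcomp Require Import all_classical all_reals all_analysis.
Import Order.TTheory GRing.Theory Num.Theory.
Import numFieldNormedType.Exports.
Local Open Scope classical_set_scope.
Local Open Scope ring_scope.

(** In this space weak convergence matters only through the coordinates: each
coordinate [x |-> x k] is a bounded linear functional ([coord_continuous]), and
coordinatewise convergence on the unit sphere already forces convergence in
norm.

Since [p] is bounded by some [P], scaling by [c >= 1] multiplies the modular
[rho] by at most [c `^ P] ([rhoZ_ge1]).  This growth condition ties norm and
modular together in two ways: a vector of norm 1 has modular exactly 1
([rho_eq1]), and a small modular forces a small norm ([luxemburg_le]).  It is
therefore enough to show that [rho (u n - x)] tends to 0 when all the [u n] and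
[x] have modular 1 and [u n] tends to [x] coordinatewise ([rho_sub_cvg0]).

The argument is that of Scheffe's lemma.  A window mean depends on finitely
many coordinates, so each term of the series [rho (u n)] converges to the
corresponding term of [rho x].  Cut the series at an index [N] where the head
of [rho x] has nearly exhausted the total mass 1.  The head of [rho (u n)] is
then eventually just as close to 1, and because the total mass is again 1, the
tail of [rho (u n)] is small too: no mass escapes to infinity.  The tail of
[rho (u n - x)] is at most [2 `^ P] times the sum of these two tails, and its
head is a finite sum of terms tending to 0. *)

(** * Powers and window means *)

(** At [a > 0] the power function is differentiable; at [a = 0] it is not
covered by the derivative and continuity is read off from monotonicity. *)
Lemma cvg_powR {R : realType} {T : Type} {F : set_system T} {FF : Filter F}
    (q : R) (f : T -> R) (a : R) :
  0 < q -> (forall t, 0 <= f t) -> 0 <= a -> f @ F --> a ->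
  f t `^ q @[t --> F] --> a `^ q.
Proof.
move=> q0 f0 + fa; rewrite le_eqVlt => /predU1P[a0|a0].
  rewrite -a0 powR0 ?gt_eqF//; apply/cvgrPdist_lt => e e0.
  have d0 : 0 < e `^ q^-1 by rewrite powR_gt0.
  move/cvgrPdist_lt : fa => /(_ _ d0); rewrite -a0; apply: filterS => t.
  rewrite !sub0r !normrN !ger0_norm ?powR_ge0// => ft.
  have <- : (e `^ q^-1) `^ q = e.
    by rewrite -powRrM mulVf ?gt_eqF// powRr1// ltW.
  by rewrite gt0_ltr_powR// nnegrE ?powR_ge0.
apply: (@continuous_cvg _ _ _ _ _ f (fun x => x `^ q)) => //.
apply/differentiable_continuous/derivable1_diffP.
by apply: derivable_powR; rewrite in_itv/= a0.
Qed.

Lemma window_mean_cvg {R : realType} (lam : nat -> R) (u : nat -> nat -> R)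
    (x : nat -> R) (k : nat) :
  (forall j, u n j @[n --> \oo] --> x j) ->
  window_mean lam (u n) k @[n --> \oo] --> window_mean lam x k.
Proof.
move=> ux; apply: cvgMr; apply: cvg_big => [|j _]; first exact: add_continuous.
exact: cvg_norm.
Qed.

(** The constant depends on the bound [P] only, so that it can be factored out
of a series whose exponents vary.  It comes from [s + t <= 2 * max s t]. *)
Lemma powRD_le_bound {R : realType} (P q s t : R) : 0 <= q <= P -> 0 <= s -> 0 <= t ->
  (s + t) `^ q <= 2 `^ P * (s `^ q + t `^ q).
Proof.
move=> /andP[q0 qP] s0 t0.
wlog st : s t s0 t0 / s <= t.
  move=> H; have [st|/ltW ts] := leP s t; first exact: H.
  by rewrite addrC [X in _ * X]addrC; exact: H.
apply: (@le_trans _ _ ((2 * t) `^ q)).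
  by rewrite ge0_ler_powR ?nnegrE ?addr_ge0 ?mulr_ge0//; lra.
rewrite powRM//; apply: ler_pM; rewrite ?powR_ge0//.
  by rewrite ler_powR// ler1n.
by rewrite lerDr powR_ge0.
Qed.

(** * Modular and norm *)

Section modular.
Context {R : realType} (lam p : nat -> R) (P : R).
Context (lam_nd : nondecreasing_seq lam) (lam0 : lam 0%N = 1)
  (p_gt1 : forall k, 1 < p k) (p_leP : forall k, p k <= P).
Implicit Types (x y : nat -> R) (c e : R).

Let wm0 x k : 0 <= window_mean lam x k.
Proof. exact: window_mean_ge0. Qed.

Let p_gt0 k : 0 < p k.
Proof. exact: lt_trans (p_gt1 k). Qed.

Let P_gt0 : 0 < P.
Proof. exact: lt_le_trans (p_gt0 0%N) (p_leP 0%N). Qed.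

Lemma rhoZ_ge1 c x : 1 <= c ->
  (rho lam p (c *: x)%R <= (c `^ P)%:E * rho lam p x)%E.
Proof.
move=> c1; have c0 : 0 <= c by lra.
rewrite !rhoE -nneseriesZl; last by move=> k _; rewrite lee_fin powR_ge0.
apply: lee_nneseries => [k _ _|k _]; first by rewrite lee_fin powR_ge0.
rewrite -EFinM lee_fin window_meanZ ger0_norm// powRM//.
by rewrite ler_wpM2r ?powR_ge0// ler_powR.
Qed.

(** Dividing by [e] costs a factor [e^-1 `^ P] at most, which brings the
modular down to 1 and makes [e] admissible in the infimum. *)
Lemma luxemburg_le e x : 0 < e <= 1 -> (rho lam p x <= (e `^ P)%:E)%E ->
  luxemburg lam p x <= e.
Proof.
move=> /andP[e0 e1] xe; apply: ge_inf; first by exists 0 => s [/ltW].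
split => //; apply: (le_trans (rhoZ_ge1 _ _ _)); first by rewrite invf_ge1.
apply: (@le_trans _ _ ((e^-1 `^ P)%:E * (e `^ P)%:E)%E).
  by rewrite lee_wpmul2l// lee_fin powR_ge0.
have e0' : 0 <= e by exact: ltW.
by rewrite -EFinM -powRM ?invr_ge0// mulVf ?powR1// gt_eqF.
Qed.

(** If the norm is 1, every [c > 1] exceeds an admissible scale, so the modular is
at most [c `^ P], which is arbitrarily close to 1.  If the modular were less
than 1, there would be room to scale the vector up, and the norm would be
less than 1. *)
Lemma rho_eq1 x : luxemburg lam p x = 1 -> rho lam p x = 1%E.
Proof.
move=> x1; apply/eqP; rewrite eq_le; apply/andP; split.
  apply/lee_addgt0Pr => e e0.
  (* chosen so that c `^ P is 1 + e *)
  pose c := (1 + e) `^ P^-1.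
  have c1 : 1 < c.
    have <- : 1 `^ P^-1 = 1 :> R by rewrite powR1.
    by rewrite gt0_ltr_powR ?invr_gt0 ?nnegrE//; lra.
  have cP : c `^ P = 1 + e.
    by rewrite -powRrM mulVf ?gt_eqF// powRr1//; lra.
  have c0 : 0 < c by lra.
  have hinf : has_inf [set s : R | 0 < s /\ (rho lam p (s^-1 *: x)%R <= 1)%E].
    split; last by exists 0 => s [/ltW].
    (* without admissible scale the infimum would be 0 by convention *)
    apply/set0P/negP => /eqP S0; move: x1; rewrite /luxemburg S0 inf0 => /eqP.
    by rewrite eq_sym oner_eq0.
  have c1' : 0 < c - 1 by rewrite subr_gt0.
  have [s [s0 xs]] := inf_adherent c1' hinf.
  rewrite -/(luxemburg lam p x) x1 addrC subrK => sc.
  have -> : x = c *: ((s / c) *: (s^-1 *: x)).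
    by rewrite !scalerA mulrCA divff ?gt_eqF// mulr1 divff ?gt_eqF// scale1r.
  apply: (le_trans (rhoZ_ge1 _ _ (ltW c1))).
  rewrite cP -EFinD -[leRHS]mule1; apply: lee_wpmul2l.
    by rewrite lee_fin; lra.
  have sc01 : 0 <= s / c <= 1.
    apply/andP; split; first by apply: divr_ge0; exact: ltW.
    by rewrite ler_pdivrMr// mul1r ltW.
  apply: (le_trans (rhoZ_le lam_nd lam0 p_gt1 _ sc01)).
  apply: (@le_trans _ _ ((s / c)%:E * 1)%E).
    by apply: lee_wpmul2l => //; rewrite lee_fin; case/andP: sc01.
  by rewrite mule1 lee_fin; case/andP: sc01.
rewrite leNgt; apply/negP => xlt1.
have xfin : rho lam p x \is a fin_num.
  by rewrite ge0_fin_numE ?rho_ge0//; exact: lt_trans xlt1 (ltry _).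
(* the maximum with 1/2 keeps r positive when the modular vanishes *)
pose r := Num.max 2^-1 (fine (rho lam p x)).
have r1 : r < 1.
  by rewrite gt_max; apply/andP; split; [lra|rewrite -lte_fin fineK].
have r0 : 0 < r by rewrite lt_max; apply/orP; left; lra.
pose e := r `^ P^-1.
have eP : e `^ P = r by rewrite -powRrM mulVf ?gt_eqF// powRr1// ltW.
have e1 : e < 1.
  have <- : 1 `^ P^-1 = 1 :> R by rewrite powR1.
  by rewrite gt0_ltr_powR ?invr_gt0 ?nnegrE// ltW.
suff : luxemburg lam p x <= e by rewrite x1 leNgt e1.
apply: luxemburg_le; first by rewrite powR_gt0//= ltW.
by rewrite eP -(fineK xfin) lee_fin le_max lexx orbT.
Qed.

(** * Coordinatewise convergence on the modular sphere *)

Let term x k := window_mean lam x k `^ p k.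

Let rho_split x N : (rho lam p x =
  (\sum_(0 <= k < N) term x k)%:E + \sum_(N <= k <oo) (term x k)%:E)%E.
Proof.
rewrite rhoE (nneseries_split 0 N) ?add0n ?sumEFin//.
by move=> k _; rewrite lee_fin powR_ge0.
Qed.

Let tail_ge0 x N : (0 <= \sum_(N <= k <oo) (term x k)%:E)%E.
Proof. by apply: nneseries_ge0 => k _ _; rewrite lee_fin powR_ge0. Qed.

Let term_subadd x y k : term (y - x) k <= 2 `^ P * (term y k + term x k).
Proof.
have q : 0 <= p k <= P by rewrite p_leP ltW.
apply: le_trans (powRD_le_bound _ _ _ _ q (wm0 y k) (wm0 x k)).
rewrite ge0_ler_powR ?nnegrE ?addr_ge0 ?(ltW (p_gt0 k))//.
apply: (le_trans (window_meanD lam_nd lam0 _ _ _)).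
by rewrite -scaleN1r window_meanZ normrN1 mul1r.
Qed.

Let tail_subadd x y N : (\sum_(N <= k <oo) (term (y - x) k)%:E <= (2 `^ P)%:E *
  (\sum_(N <= k <oo) (term y k)%:E + \sum_(N <= k <oo) (term x k)%:E))%E.
Proof.
have t0 z k : (0 <= (term z k)%:E)%E by rewrite lee_fin powR_ge0.
rewrite -nneseriesD// -nneseriesZl; last by move=> k _; rewrite adde_ge0.
by apply: lee_nneseries => // k _; rewrite -EFinD -EFinM lee_fin.
Qed.

Let tail_le x N e : rho lam p x = 1%E -> 1 - e < \sum_(0 <= k < N) term x k ->
  (\sum_(N <= k <oo) (term x k)%:E <= e%:E)%E.
Proof.
move=> x1 he; have := rho_split x N; rewrite x1.
case: (\big[_/_]_(N <= k <oo) _) (tail_ge0 x N) => // t _.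
by rewrite -EFinD => -[]; rewrite lee_fin; lra.
Qed.

(** A Scheffe argument: since the total mass is 1 for all the [u n] and for [x],
an index [N] whose head carries mass more than [1 - d] for [x] eventually does
so for [u n], which controls all the tails at once. *)
Lemma rho_sub_cvg0 (u : nat -> nat -> R) x :
  (forall n, rho lam p (u n) = 1%E) -> rho lam p x = 1%E ->
  (forall k, u n k @[n --> \oo] --> x k) ->
  forall e, 0 < e -> \forall n \near \oo, (rho lam p (u n - x)%R <= e%:E)%E.
Proof.
move=> u1 x1 ux e e0.
have termcvg (v : nat -> nat -> R) y : (forall k, v n k @[n --> \oo] --> y k) ->
    forall N, \sum_(0 <= k < N) term (v n) k @[n --> \oo] -->
      \sum_(0 <= k < N) term y k.
  move=> vy N; apply: cvg_big => [|k _]; first exact: add_continuous.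
  apply: cvg_powR => //.
  exact: window_mean_cvg.
(* d pays for the head, and 2 `^ P * (d + d) for the two tails *)
pose d := e / (1 + 2 * 2 `^ P).
have P0 : 0 < 2 `^ P by rewrite powR_gt0.
have d0 : 0 < d by rewrite divr_gt0//; lra.
have eE : e = d + 2 `^ P * (d + d).
  rewrite -[LHS](@divfK _ (1 + 2 * 2 `^ P)) -/d; first by ring.
  by rewrite gt_eqF//; lra.
have [N hN] : exists N, 1 - d < \sum_(0 <= k < N) term x k.
  have tx : (\sum_(0 <= k < N) (term x k)%:E)%E @[N --> \oo] --> 1%E.
    rewrite -x1 rhoE; apply: is_cvg_nneseries => k _ _.
    by rewrite lee_fin powR_ge0.
  have {}tx : \sum_(0 <= k < N) term x k @[N --> \oo] --> (1 : R).
    by move/fine_cvgP : tx => [_]; under eq_fun do rewrite /= sumEFin.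
  have lt1 : 1 - d < 1 by lra.
  have [N _ /(_ N (leqnn N))] := cvgr_gt _ tx _ lt1.
  by exists N.
have diff0 k : (u n - x) k @[n --> \oo] --> (0 : nat -> R) k.
  have -> : (0 : nat -> R) k = x k - x k by rewrite subrr.
  by apply: cvgB => //; exact: cvg_cst.
have head0 := termcvg (fun n => u n - x) 0 diff0 N.
have t0 : \sum_(0 <= k < N) term 0 k = 0.
  rewrite big1// => k _; rewrite /term -(scale0r (0 : nat -> R)) window_meanZ.
  by rewrite normr0 mul0r powR0// gt_eqF.
rewrite t0 in head0.
near=> n.
rewrite (rho_split _ N).
rewrite eE EFinD; apply: leeD.
  rewrite lee_fin ltW//; near: n; exact: (cvgr_lt _ head0).
apply: (le_trans (tail_subadd _ _ _)).
rewrite EFinM; apply: lee_wpmul2l; first by rewrite lee_fin ltW.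
rewrite EFinD; apply: leeD; apply: tail_le => //.
near: n; exact: (cvgr_gt _ (termcvg u x ux N)).
Unshelve. all: by end_near. Qed.

(** * Coordinate functionals *)

Local Notation V := (Vrho lam_nd lam0 p_gt1).

(** By homogeneity one may take a vector of norm 1.  Its modular is then 1,
so each window mean is at most 1, and [k] belongs to its own window. *)
Lemma coord_le_norm (x : V) k : `|(x : nat -> R) k| <= lam k * `|x|.
Proof.
have lam1 : 1 <= lam k by rewrite -lam0 lam_nd.
have rho1 y : rho lam p y = 1%E -> `|y k| <= lam k.
  move=> y1.
  have wm1 : window_mean lam y k <= 1.
    have : term y k <= 1.
      rewrite -lee_fin -y1 rhoE (@nneseriesD1 _ _ k)//; last first.
        by move=> i _; rewrite lee_fin powR_ge0.
      by rewrite leeDl// nneseries_ge0// => i _ _; rewrite lee_fin powR_ge0.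
    rewrite !leNgt; apply: contra => w1.
    have <- : 1 `^ p k = 1 :> R by rewrite powR1.
    by rewrite gt0_ltr_powR ?nnegrE ?wm0.
  rewrite -[leRHS]mulr1 -ler_pdivrMl; last by lra.
  apply: le_trans wm1; rewrite ler_wpM2l ?invr_ge0//; first by lra.
  rewrite (bigD1 ord_max)/=; last by lra.
  by rewrite lerDl sumr_ge0.
have [->|x0] := eqVneq x 0; first by rewrite !normr0 mulr0.
have nx0 : 0 < `|x| by rewrite normr_gt0.
rewrite -ler_pdivrMr// mulrC -[X in X * _](gtr0_norm (_ : 0 < `|x|^-1)).
  rewrite -normrM; apply: (rho1 (`|x|^-1 *: x)); apply: rho_eq1.
  rewrite -[LHS](Vrho_normE (`|x|^-1 *: x)) normrZ gtr0_norm ?invr_gt0//.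
  by rewrite mulVf ?gt_eqF.
by rewrite invr_gt0.
Qed.

Definition coord k (x : V) : R^o := (x : nat -> R) k.

Lemma coord_is_linear k : linear (coord k).
Proof. by []. Qed.

HB.instance Definition _ k := GRing.isLinear.Build R V R^o *:%R (coord k)
  (coord_is_linear k).

Lemma coord_continuous k : continuous (coord k).
Proof.
apply: bounded_linear_continuous; apply/linear_boundedP.
near=> r => x; apply: (le_trans (coord_le_norm x k)).
by rewrite ler_wpM2r.
Unshelve. all: by end_near. Qed.

(** * Kadec-Klee property *)

Lemma vrho_kadec_klee : kadec_klee V.
Proof.
move=> u l u1 l1 ul.
have lux (x : V) : `|x| = 1 -> rho lam p x = 1%E.
  by move=> x1; apply: rho_eq1; rewrite -x1 -Vrho_normE.
have ulk k : (u n : nat -> R) k @[n --> \oo] --> (l : nat -> R) k.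
  exact: (ul (coord k) (@coord_continuous k)).
have ul0 := rho_sub_cvg0 _ _ (fun n => lux _ (u1 n)) (lux _ l1) ulk.
apply/cvgrPdist_le => e e0.
(* luxemburg_le turns modulars into norms at scales at most 1 only *)
pose d := Num.min e 1.
have d0 : 0 < d by rewrite lt_min e0 ltr01.
have := ul0 _ (powR_gt0 P d0); apply: filterS => n uln.
apply: (@le_trans _ _ d); last by rewrite ge_min lexx.
rewrite distrC Vrho_normE; apply: luxemburg_le => //.
by rewrite d0 ge_min lexx orbT.
Qed.

End modular.

Theorem theorem4p7 (R : realType) (lam p : nat -> R)
    (lam_gt0 : forall k, 0 < lam k)
    (lam_nd : nondecreasing_seq lam)
    (lam_oo : lam @ \oo --> +oo)
    (lam0 : lam 0%N = 1)
    (lamS : forall k, lam k.+1 <= lam k + 1)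
    (p_bd : bounded_fun p)
    (p_gt1 : forall k, 1 < p k) :
  kadec_klee (Vrho lam_nd lam0 p_gt1).
Proof.
have [M [_ /(_ (M + 1))]] := p_bd.
rewrite ltrDl ltr01 => /(_ isT) pM.
apply: (@vrho_kadec_klee R lam p (M + 1)) => k.
exact: le_trans (ler_norm _) (pM k I).
Qed.
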